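(* Let $X$ be the process described in the context, in the case where $\gamma(\sigma)=G_\sigma(\{1\})>0$ for all $\sigma\ge1$. For $s>0$ let $T_s$ denote the first jump time of $X$ after $s$. Then, for any $t>s$, $$\mathbb{P}[T_s>t]=\gamma(\sigma),\qquad \sigma=\sqrt{t/s}.$$
   Context: $\varepsilon_a$ is the Dirac measure at $a$; $\phi(\mu,v,\cdot)$ is the density of the Gaussian distribution with mean $\mu$ and variance $v$. A family $(G_\sigma)_{\sigma\ge1}$ of probability measures on $[0,1]$ is a log-convolution semi-group if, for all $\sigma,\tau\ge1$, the product of two independent random variables with distributions $G_\sigma$ and $G_\tau$ has distribution $G_{\sigma\tau}$. It has Laplace exponent $\psi(\lambda)=\beta\lambda+\int_0^\infty(1-e^{-\lambda x})\nu(dx)$ if, for $R_\sigma$ distributed as $G_\sigma$, $L_\sigma(\lambda):=\mathbb{E}[(R_\sigma)^\lambda]=\sigma^{-\psi(\lambda)}$ for all $\sigma\ge1$, $\lambda>0$, where $\beta\ge0$ and $\nu$ is a measure on $[0,\infty)$ with $\nu(\{0\})=0$ and $\int_0^\infty(1\wedge x)\nu(dx)<\infty$. Standing setting: $(G_\sigma)_{\sigma\ge1}$ is a log-convolution semi-group with Laplace exponent $\psi$ satisfying $\psi(1/2)=1$. $X$ is the Markov martingale with $X_0=0$, with right-continuous paths having left limits, and with transition probabilities: $P_{0,t}(x,dy)=\phi(x,t,y)\,dy$ for $t>0$, and for $0<s<t$, with $\sigma=\sqrt{t/s}$ and $\gamma(\sigma)=G_\sigma(\{1\})$, $$P_{s,t}(x,dy)=\gamma(\sigma)\,\varepsilon_{\sigma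 x}(dy)+\left(\int_{[0,1)}\phi\big(\sigma\sqrt r\,x,\;t(1-r),\;y\big)\,G_\sigma(dr)\right)dy.$$ The first jump time after $s$ is $T_s=\inf\{u>s: X_u\ne X_{u-}\}$. *)

(* Defs.v *)
From HB Require Import structures.
From mathcomp Require Import all_boot all_order all_algebra.
From mathcomp Require Import all_classical all_reals all_analysis.
From mathcomp Require Import measurable_realfun.

Set Implicit Arguments.
Unset Strict Implicit.
Unset Printing Implicit Defensive.

Import Order.TTheory GRing.Theory Num.Theory.
Import numFieldNormedType.Exports.

Local Open Scope classical_set_scope.
Local Open Scope ring_scope.

Definition independent_pair {d} {T : measurableType d} {R : realType}
    (P : probability T R) (U V : {RV P >-> R}) : Prop :=
  forall A B : set R, measurable A -> measurable B ->
    P (U @^-1` A `&` V @^-1` B) = (P (U @^-1` A) * P (V @^-1` B))%E.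

Definition has_distribution {d} {T : measurableType d} {R : realType}
    (P : probability T R) (U : T -> R)
    (m : probability (measurableTypeR R) R) : Prop :=
  forall B : set R, measurable B -> P (U @^-1` B) = m B.

(* A family of probability measures on [0, 1] is encoded by probability
   measures on R giving mass 1 to [0, 1]; only the indices sigma >= 1 matter. *)
Definition log_convolution_semigroup {R : realType}
    (G : R -> probability (measurableTypeR R) R) : Prop :=
  (forall sigma : R, 1 <= sigma -> G sigma `[0, 1]%classic = 1%E) /\
  (forall sigma tau : R, 1 <= sigma -> 1 <= tau ->
    forall (d : measure_display) (T : measurableType d) (P : probability T R)
      (U V : {RV P >-> R}),
      independent_pair U V ->
      has_distribution P U (G sigma) -> has_distribution P V (G tau) ->
      has_distribution P (fun w => U w * V w) (G (sigma * tau))).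

(* A measure on [0, +oo[ is encoded by a measure on R vanishing on ]-oo, 0[. *)
Definition drift_levy_pair {R : realType} (beta : R)
    (nu : {measure set (measurableTypeR R) -> \bar R}) : Prop :=
  [/\ 0 <= beta,
      nu `]-oo, 0[%classic = 0%E,
      nu [set 0] = 0%E &
      (\int[nu]_(x in `[0%R, +oo[) (Num.min 1 x)%:E < +oo)%E].

Definition laplace_exponent {R : realType} (beta : R)
    (nu : {measure set (measurableTypeR R) -> \bar R}) (lambda : R) : R :=
  beta * lambda + \int[nu]_(x in `[0, +oo[) (1 - expR (- (lambda * x))).

Definition has_laplace_exponent {R : realType}
    (G : R -> probability (measurableTypeR R) R) (psi : R -> R) : Prop :=
  forall sigma lambda : R, 1 <= sigma -> 0 < lambda ->
    ('E_(G sigma)[fun r : R => (r `^ lambda)%R] = (sigma `^ (- psi lambda))%:E)%E.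

(* [normal_pdf] takes the standard deviation, [gauss_density] the variance. *)
Definition gauss_density {R : realType} (m v y : R) : R :=
  normal_pdf m (Num.sqrt v) y.

Definition transition {R : realType}
    (G : R -> probability (measurableTypeR R) R) (s t x : R) (B : set R)
    : \bar R :=
  if s == 0 then (\int[lebesgue_measure]_(y in B) (gauss_density x t y)%:E)%E
  else let sigma := Num.sqrt (t / s) in
    (G sigma [set 1%R] * \d_(sigma * x)%R B +
     \int[lebesgue_measure]_(y in B) \int[G sigma]_(r in `[0%R, 1%R[)
        (gauss_density (sigma * Num.sqrt r * x) (t * (1 - r)) y)%:E)%E.

Definition natural_filtration {d} {T : measurableType d} {R : realType}
    (P : probability T R) (X : R -> {RV P >-> R}) (s : R) : set (set T) :=
  <<s [set A | exists (u : R) (B : set R),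
         [/\ 0 <= u, u <= s, measurable B & A = X u @^-1` B]] >>.

(* [Y] is a version of the conditional expectation of [Z] given the
   sub-sigma-algebra [F]. *)
Definition is_cond_expectation {d} {T : measurableType d} {R : realType}
    (P : probability T R) (F : set (set T)) (Z Y : T -> \bar R) : Prop :=
  (forall B : set (\bar R), measurable B -> F (Y @^-1` B)) /\
  (forall A, F A -> (\int[P]_(w in A) Y w = \int[P]_(w in A) Z w)%E).

Definition martingale {d} {T : measurableType d} {R : realType}
    (P : probability T R) (X : R -> {RV P >-> R}) : Prop :=
  (forall t : R, 0 <= t -> P.-integrable setT (EFin \o X t)) /\
  (forall s t : R, 0 <= s -> s < t ->
    is_cond_expectation P (natural_filtration X s)
      (EFin \o X t) (EFin \o X s)).

Definition markov_with_transition {d} {T : measurableType d} {R : realType}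
    (P : probability T R) (X : R -> {RV P >-> R})
    (p : R -> R -> R -> set R -> \bar R) : Prop :=
  forall (s t : R) (B : set R), 0 <= s -> s < t -> measurable B ->
    is_cond_expectation P (natural_filtration X s)
      (fun w => (\1_(X t @^-1` B) w)%:E) (fun w => p s t (X s w) B).

Definition cadlag {R : realType} (f : R -> R) : Prop :=
  (forall t : R, 0 <= t -> f u @[u --> t^'+] --> f t) /\
  (forall t : R, 0 < t -> cvg (f u @[u --> t^'-])).

Definition left_limit {R : realType} (f : R -> R) (u : R) : R :=
  lim (f v @[v --> u^'-]).

(* Valued in the extended reals: +oo when there is no jump after [s]. *)
Definition first_jump_after {R : realType} (f : R -> R) (s : R) : \bar R :=
  ereal_inf (EFin @` [set u : R | s < u /\ f u <> left_limit f u]).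

(* Main.v *)
Require Import Defs.
From HB Require Import structures.
From mathcomp Require Import all_boot all_order all_algebra.
From mathcomp Require Import all_classical all_reals all_analysis.
From mathcomp Require Import measurable_realfun ring lra.

Import Order.TTheory GRing.Theory Num.Theory.
Import numFieldNormedType.Exports.

Local Open Scope classical_set_scope.
Local Open Scope ring_scope.

Set Implicit Arguments.
Unset Strict Implicit.
Unset Printing Implicit Defensive.

(* Cut [s, t] by the geometric grid t_i = s r^(2i), i <= n = 2^k, where
   r^n = sigma, and put D_i = X_(t_(i+1)) - r X_(t_i). A cadlag path has no jump
   in ]s, t] iff max_i |D_i| tends to 0 as k tends to infinity; in particular
   this event is measurable. By the Markov property, each D_i vanishes with
   conditional probability gamma(r), and gamma(r)^n = gamma(sigma), so all the
   D_i vanish, for all k at once, with probability at least gamma(sigma).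
   Conversely |D_i| < e has conditional probability at most gamma(r) + eta, where
   eta <= C e (1 - gamma(r)) + G_r([r0, 1[), hence max_i |D_i| < e has probability
   at most gamma(sigma) + n eta. Since both n (1 - gamma(r)) and n G_r([r0, 1[) are
   controlled by the Laplace transform at sigma, uniformly in n, the term n eta
   is small when r0 is close to 1 and then e is small. Finally {T_s > t} is the
   increasing union of the events "no jump in ]s, t r^2]" over k. *)

(** * Power inequalities and iterated square roots *)

(** In the factorisation of p^n - q^n by p - q, each of the n cofactor terms is at least q^(n-1),
    hence at least q^n. When p^n and q^n are fixed and q^n > 0, this bounds n (p - q) independently
    of n. *)
Lemma exprn_sub_ge (R : realFieldType) (p q : R) n : 0 <= q -> q <= p -> q <= 1 ->
  q ^+ n * (n%:R * (p - q)) <= p ^+ n - q ^+ n.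
Proof.
move=> q0 qp q1; elim: n => [|n ih]; first by rewrite mul0r mulr0 subrr.
rewrite !exprS -natr1.
have qn0 : 0 <= q ^+ n by exact: exprn_ge0.
have pq0 : 0 <= p - q by rewrite subr_ge0.
have h1 : q * (q ^+ n * (n%:R * (p - q))) <= p * (p ^+ n - q ^+ n).
  by rewrite ler_pM// !mulr_ge0.
have h2 : q * (q ^+ n * (p - q)) <= q ^+ n * (p - q) by rewrite ler_piMl// mulr_ge0.
rewrite (_ : p * p ^+ n - q * q ^+ n = p * (p ^+ n - q ^+ n) + q ^+ n * (p - q)); last first.
  by rewrite !mulrBr (mulrC q) (mulrC (q ^+ n) p) addrA subrK.
by rewrite (le_trans _ (lerD h1 h2))// !mulrDl !mul1r !mulrDr !mulrA.
Qed.

(** Bernoulli's inequality ([B] below); it later provides a threshold below 1 whose m-th power is at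
    least 1/2. *)
Lemma half_le_exprn (R : realFieldType) (m : nat) :
  (0 < m)%N -> 2^-1 <= (1 - (m.*2)%:R^-1 : R) ^+ m.
Proof.
move=> m0; have m2 : 0 < m.*2%:R :> R by rewrite ltr0n double_gt0.
have h0 : 0 <= 1 - (m.*2)%:R^-1 :> R.
  by rewrite subr_ge0 invf_le1// ler1n double_gt0.
have B n : 1 - n%:R * (m.*2)%:R^-1 <= (1 - (m.*2)%:R^-1 : R) ^+ n.
  elim: n => [|n ih]; first by rewrite mul0r subr0.
  rewrite exprS -natr1; apply: le_trans (ler_wpM2l h0 ih).
  have : 0 <= n%:R * ((m.*2)%:R^-1 * (m.*2)%:R^-1) :> R by rewrite !mulr_ge0// invr_ge0 ltW.
  lra.
apply: le_trans (B m); rewrite -muln2 natrM invfM mulrA divff ?pnatr_eq0 -?lt0n//.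
lra.
Qed.

Lemma iter_sqrtS (R : rcfType) (rho : R) k : 0 <= rho ->
  iter k.+1 Num.sqrt rho ^+ 2 = iter k Num.sqrt rho.
Proof. by move=> r0 /=; rewrite sqr_sqrtr//; case: k => //= k; exact: sqrtr_ge0. Qed.

Lemma iter_sqrtXn (R : rcfType) (rho : R) k : 0 <= rho ->
  iter k Num.sqrt rho ^+ (2 ^ k) = rho.
Proof. by move=> r0; elim: k => // k ih; rewrite expnS exprM iter_sqrtS. Qed.

Lemma iter_sqrt_gt1 (R : rcfType) (rho : R) k : 1 < rho -> 1 < iter k Num.sqrt rho.
Proof.
move=> r1; elim: k => //= k ih.
by rewrite -[X in X < _]sqrtr1 ltr_sqrt// (lt_trans _ ih).
Qed.

(** [exprn_sub_ge] with q = 1 bounds 2^k times the distance to 1 by rho - 1, and 2^k >= k + 1. *)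
Lemma iter_sqrt_cvg1 (R : realType) (rho : R) : 1 < rho ->
  (fun k => iter k Num.sqrt rho) @ \oo --> (1 : R).
Proof.
move=> r1.
apply: (@squeeze_cvgr _ _ _ _ (cst 1) (fun k => 1 + (rho - 1) * k.+1%:R^-1)).
- near=> k; rewrite /= ltW ?iter_sqrt_gt1//= -lerBlDl.
  have := @exprn_sub_ge _ (iter k Num.sqrt rho) 1 (2 ^ k) ler01
    (ltW (iter_sqrt_gt1 k r1)) (lexx _).
  rewrite !expr1n mul1r iter_sqrtXn ?(le_trans _ (ltW r1))// => h.
  rewrite ler_pdivlMr ?ltr0Sn// mulrC; apply: le_trans h.
  apply: ler_wpM2r; first by rewrite subr_ge0 ltW ?iter_sqrt_gt1.
  by rewrite ler_nat; exact: ltn_expl.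
- exact: cvg_cst.
- rewrite -[X in _ --> X]addr0 -(mulr0 (rho - 1)).
  by apply: cvgD; [exact: cvg_cst|apply: cvgM; [exact: cvg_cst|exact: cvg_harmonic]].
Unshelve. all: by end_near. Qed.

(** * Jumps of a cadlag path read off its increments along geometric grids *)

(** Heine's theorem. In the covering form of compactness the modulus is the parameter, along the
    filter [0^'+]; around each [x], half of its continuity radius serves all nearby points. *)
Lemma within_itv_unif_continuous (R : realType) (f : R -> R) (a b : R) :
  {within `[a, b], continuous f} -> forall e : R, 0 < e -> exists2 d, 0 < d &
    forall x y, x \in `[a, b] -> y \in `[a, b] -> `|x - y| < d -> `|f x - f y| < e.
Proof.
move=> cf e e0.
pose Q (d x : R) := forall y, y \in `[a, b] -> `|x - y| < d -> `|f x - f y| < e.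
have /compact_near_coveringP /(_ R 0^'+ (fun d x => x \in `[a, b] -> Q d x) _) :=
  @segment_compact R a b.
case.
  move=> x xab.
  have e2 : 0 < e / 2 by rewrite divr_gt0.
  move/subspace_continuousP : cf => /(_ x xab) /cvgrPdist_lt /(_ _ e2).
  move=> /nbhs_ballP[d /= d0 hd].
  have d2 : 0 < d / 2 by rewrite divr_gt0.
  exists (ball x (d / 2), `]0, d / 2[%classic) => /=.
    split; first exact: nbhsx_ballx.
    by near=> z; rewrite /= in_itv/=; apply/andP; split; near: z;
      [exact: nbhs_right_gt|exact: nbhs_right_lt].
  move=> [z r] /= [xz]; rewrite in_itv/= => /andP[r0 rd] zab y yab zy.
  have h1 : `|f x - f z| < e / 2.
    apply: hd => //; apply: lt_le_trans xz _; lra.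
  have h2 : `|f x - f y| < e / 2.
    apply: hd => //=; rewrite /ball/= -(subrK z x) -addrA.
    rewrite (le_lt_trans (ler_normD _ _))// [ltRHS]splitr.
    by rewrite ltrD// (lt_trans zy).
  rewrite -(subrK (f x) (f z)) -addrA (le_lt_trans (ler_normD _ _))// [ltRHS]splitr.
  by rewrite ltrD// distrC.
move=> d /= d0 hd; exists (d / 2); first by rewrite divr_gt0.
move=> x y xab yab xy; apply: (hd (d / 2)) => //=.
  by rewrite sub0r normrN gtr0_norm ?divr_gt0// ltr_pdivrMr// ltr_pMr// ltr1n.
by rewrite divr_gt0.
Unshelve. all: by end_near. Qed.

(* The i-th point of the geometric subdivision of [s, s rho^2] into 2^k cells. *)
Definition grid (R : rcfType) (s rho : R) k i := s * iter k Num.sqrt rho ^+ (2 * i).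

(* Vanishes when f u / sqrt u is constant, as happens for X between two jumps. *)
Definition grid_increment (R : rcfType) (f : R -> R) (s rho : R) k i :=
  f (grid s rho k i.+1) - iter k Num.sqrt rho * f (grid s rho k i).

Section grid.
Variables (R : realType) (s rho : R).
Hypotheses (s0 : 0 < s) (rho1 : 1 < rho).

Let rho0 : 0 <= rho. Proof. by rewrite (le_trans _ (ltW rho1)). Qed.

Let root_gt0 k : 0 < iter k Num.sqrt rho.
Proof. by rewrite (lt_trans _ (iter_sqrt_gt1 k rho1)). Qed.

Lemma grid0 k : grid s rho k 0 = s.
Proof. by rewrite /grid muln0 expr0 mulr1. Qed.

Lemma grid_last k : grid s rho k (2 ^ k) = s * rho ^+ 2.
Proof. by rewrite /grid mulnC exprM iter_sqrtXn. Qed.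

(** The grids are nested, which later makes the events of vanishing increments decrease in [k]. *)
Lemma grid_double k i : grid s rho k.+1 (2 * i) = grid s rho k i.
Proof. by rewrite /grid exprM iter_sqrtS. Qed.

Lemma gridS k i : grid s rho k i.+1 = iter k Num.sqrt rho ^+ 2 * grid s rho k i.
Proof. by rewrite /grid mulrCA mulnS exprD. Qed.

Lemma ltr_grid k i j : (grid s rho k i < grid s rho k j) = (i < j)%N.
Proof. by rewrite /grid ltr_pM2l// ltr_eXn2l ?iter_sqrt_gt1// ltn_mul2l. Qed.

Lemma ler_grid k i j : (grid s rho k i <= grid s rho k j) = (i <= j)%N.
Proof. by rewrite !leNgt ltr_grid -leqNgt. Qed.

Lemma grid_ge k i : s <= grid s rho k i.
Proof. by rewrite -{1}(grid0 k) ler_grid. Qed.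

Lemma grid_gt0 k i : 0 < grid s rho k i.
Proof. exact: lt_le_trans s0 (grid_ge _ _). Qed.

Lemma grid_in k i : (i <= 2 ^ k)%N -> grid s rho k i \in `[s, s * rho ^+ 2].
Proof. by move=> ik; rewrite in_itv/= grid_ge -(grid_last k) ler_grid. Qed.

Lemma grid_mesh k i : (i < 2 ^ k)%N ->
  grid s rho k i.+1 - grid s rho k i <= s * rho ^+ 2 * (iter k Num.sqrt rho ^+ 2 - 1).
Proof.
move=> ik; rewrite gridS -{2}[grid s rho k i]mul1r -mulrBl mulrC ler_wpM2r//.
  by rewrite subr_ge0 expr_ge1 ?ltW ?root_gt0 ?iter_sqrt_gt1.
by rewrite -(grid_last k) ler_grid ltnW.
Qed.

(** The cells are open on the left, so that the left end stays strictly before [u], where the left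
    limit is tested. The right end is the first grid point not before [u]. *)
Lemma grid_cell k u : s < u -> u <= s * rho ^+ 2 ->
  exists2 i, (i < 2 ^ k)%N & grid s rho k i < u <= grid s rho k i.+1.
Proof.
move=> su; rewrite -(grid_last k) => ut.
have ex : exists i, u <= grid s rho k i by exists (2 ^ k)%N.
case: (ex_minnP ex) => -[|i] ui imin.
  by move: ui; rewrite grid0 leNgt su.
exists i; first exact: imin.
by rewrite ui andbT ltNge; apply/negP => /imin; rewrite ltnn.
Qed.

Lemma grid_mesh_cvg0 :
  s * rho ^+ 2 * (iter k Num.sqrt rho ^+ 2 - 1) @[k --> \oo] --> 0.
Proof.
rewrite -(mulr0 (s * rho ^+ 2)) -(subrr (1 : R)).
apply: cvgM; first exact: cvg_cst.
apply: cvgB; last exact: cvg_cst.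
under eq_cvg do rewrite expr2.
have c := iter_sqrt_cvg1 rho1.
by have := @cvgM _ _ _ _ _ _ _ _ c c; rewrite mulr1; apply.
Qed.

Variable f : R -> R.
Hypothesis cf : cadlag f.

Let left_cvg u : 0 < u -> f v @[v --> u^'-] --> left_limit f u.
Proof. by case: cf => _ /[apply]. Qed.

(** Without jumps the path is continuous on the closed interval. The increment splits into f(t') -
    f(t), small by uniform continuity, and (1 - r) f(t), small because f is bounded there and r
    tends to 1. *)
Lemma no_jump_grid_increment :
  (forall u, s < u -> u <= s * rho ^+ 2 -> f u = left_limit f u) ->
  forall e : R, 0 < e -> \forall k \near \oo,
    forall i, (i < 2 ^ k)%N -> `|grid_increment f s rho k i| < e.
Proof.
move=> nj e e0.
have stu : s < s * rho ^+ 2.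
  by rewrite -{1}(grid0 0) -(grid_last 0) ltr_grid.
have cont : {within `[s, s * rho ^+ 2], continuous f}.
  apply/continuous_within_itvP => //; split.
  - move=> u; rewrite in_itv/= => /andP[su ut]; apply/left_right_continuousP; split.
      by rewrite nj ?(ltW ut)//; apply: left_cvg; exact: lt_trans su.
    by apply: cf.1; rewrite ltW// (lt_trans s0).
  - by apply: cf.1; exact: ltW.
  - by rewrite nj//; apply: left_cvg; exact: lt_trans stu.
have [M0 M0in bd0] : exists2 c, c \in `[s, s * rho ^+ 2] &
    forall t, t \in `[s, s * rho ^+ 2] -> `|f t| <= `|f c|.
  apply: (@EVT_max _ (fun x => `|f x|)); first exact: ltW.
  apply/subspace_continuousP => x xi.
  by apply: cvg_norm; move/subspace_continuousP : cont; exact.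
set M := `|f M0| in bd0.
have e2 : 0 < e / 2 by rewrite divr_gt0.
have [d d0 hd] := within_itv_unif_continuous cont e2.
have := grid_mesh_cvg0 => /cvgrPdist_lt /(_ _ d0) mesh.
have := iter_sqrt_cvg1 rho1 => /cvgrPdist_lt /(_ (e / 2 / (M + 1))) => sq.
have M1 : 0 < M + 1 by rewrite ltr_wpDl // /M normr_ge0.
have {}sq := sq (divr_gt0 e2 M1).
near=> k => i ik.
rewrite /grid_increment (_ : f (grid s rho k i.+1) - _ =
  (f (grid s rho k i.+1) - f (grid s rho k i)) +
  (1 - iter k Num.sqrt rho) * f (grid s rho k i)); last by ring.
rewrite (le_lt_trans (ler_normD _ _))// [ltRHS]splitr ltr_leD//.
  apply: hd; [exact: grid_in|by apply: grid_in; exact: ltnW|].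
  rewrite ger0_norm ?subr_ge0 ?ler_grid// (le_lt_trans (grid_mesh ik))//.
  apply: le_lt_trans (ler_norm _) _; rewrite -normrN -sub0r.
  by near: k.
rewrite normrM -[leRHS](divfK (lt0r_neq0 M1)) ler_pM//.
  by apply: ltW; near: k.
by rewrite (le_trans (bd0 _ _)) ?lerDl// grid_in// ltnW.
Unshelve. all: by end_near. Qed.

(** The cell around [u] shrinks: the path tends to [f u] along its right ends and to the left limit
    along its left ends, so the increment tends to the jump at [u]. Four errors arise, each at most
    e/4: one per end, the increment itself, and the factor 1 - r. *)
Lemma grid_increment_no_jump :
  (forall e : R, 0 < e -> \forall k \near \oo,
    forall i, (i < 2 ^ k)%N -> `|grid_increment f s rho k i| < e) ->
  forall u, s < u -> u <= s * rho ^+ 2 -> f u = left_limit f u.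
Proof.
move=> small u su ut; have u0 : 0 < u by exact: lt_trans su.
set l := left_limit f u.
apply/eqP; rewrite -subr_eq0 -normr_eq0 eq_le normr_ge0 andbT.
apply/ler_addgt0Pl => e e0; rewrite addr0.
have e4 : 0 < e / 4 by rewrite divr_gt0.
have L1 : 0 < `|l| + e / 4 by rewrite ltr_wpDl.
have /cvgrPdist_lt /(_ _ e4) /nbhs_ballP[dr /= dr0 hr] := cf.1 _ (ltW u0).
have /cvgrPdist_lt /(_ _ e4) /nbhs_ballP[dl /= dl0 hl] := left_cvg u0.
have := small _ e4.
have := grid_mesh_cvg0 => /cvgrPdist_lt /(_ dr dr0) mesh1.
have := grid_mesh_cvg0 => /cvgrPdist_lt /(_ dl dl0) mesh2.
have := iter_sqrt_cvg1 rho1 => /cvgrPdist_lt /(_ _ (divr_gt0 e4 L1)) sq sm.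
near \oo => k.
have [i ik /andP[iu ui]] := grid_cell k su ut.
have meshle := grid_mesh ik.
have m1 : s * rho ^+ 2 * (iter k Num.sqrt rho ^+ 2 - 1) < dr.
  by apply: le_lt_trans (ler_norm _) _; rewrite -normrN -sub0r; near: k.
have m2 : s * rho ^+ 2 * (iter k Num.sqrt rho ^+ 2 - 1) < dl.
  by apply: le_lt_trans (ler_norm _) _; rewrite -normrN -sub0r; near: k.
have q1 : `|f u - f (grid s rho k i.+1)| < e / 4.
  move: ui; rewrite le_eqVlt => /orP[/eqP <-|ui]; first by rewrite subrr normr0.
  apply: hr => //; rewrite /ball/= distrC gtr0_norm ?subr_gt0//; lra.
have q2 : `|l - f (grid s rho k i)| < e / 4.
  apply: hl => //; rewrite /ball/= gtr0_norm ?subr_gt0//; lra.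
have q3 : `|f (grid s rho k i)| <= `|l| + e / 4.
  rewrite -[f _](subrK l) addrC (le_trans (ler_normD _ _))// lerD2l distrC ltW//.
have q4 : `|(1 - iter k Num.sqrt rho) * f (grid s rho k i)| <= e / 4.
  rewrite normrM -[leRHS](divfK (lt0r_neq0 L1)) ler_pM//.
  by apply: ltW; near: k.
have q5 : `|grid_increment f s rho k i| < e / 4.
  move: i ik {iu ui meshle q1 q2 q3 q4}; near: k; exact: sm.
rewrite (_ : f u - l = (f u - f (grid s rho k i.+1)) + grid_increment f s rho k i
  - (1 - iter k Num.sqrt rho) * f (grid s rho k i) - (l - f (grid s rho k i))); last first.
  by rewrite /grid_increment; ring.
apply: le_trans (ler_normB _ _) _.
have := ler_normB (f u - f (grid s rho k i.+1) + grid_increment f s rho k i)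
  ((1 - iter k Num.sqrt rho) * f (grid s rho k i)).
have := ler_normD (f u - f (grid s rho k i.+1)) (grid_increment f s rho k i).
lra.
Unshelve. all: by end_near. Qed.

End grid.

(** * Moments of a law on [0, 1] and its mass at and near 1 *)

Section moments.
Variables (R : realType) (mu : probability (measurableTypeR R) R).

(** On [0, 1] the powers x^m are bounded by 1 and tend to the indicator of 1, so dominated
    convergence applies. *)
Lemma integral_powR_cvg : mu `[0, 1]%classic = 1%E ->
  (\int[mu]_x (x `^ m%:R)%:E)%E @[m --> \oo] --> mu [set 1].
Proof.
move=> mu01.
have m01 : measurable (`[0, 1]%classic : set (measurableTypeR R)) by exact: measurable_itv.
(* Discards the complement of [0, 1], a null set on which the powers are not dominated. *)
have restr (f : R -> \bar R) : measurable_fun (setT : set (measurableTypeR R)) f ->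
    (forall x, 0 <= f x)%E ->
    (\int[mu]_x f x = \int[mu]_(x in `[0%R, 1%R]) f x)%E.
  move=> mf f0; rewrite (@ge0_negligible_integral _ _ _ mu setT (~` `[0, 1]) f)//=.
  - by rewrite setTD setCK.
  - exact: measurableC.
  - by rewrite probability_setC// [X in (_ - X)%E]mu01 subee.
rewrite [X in _ --> X](_ : _ = \int[mu]_(x in `[0%R, 1%R]) (\1_[set 1%R] x)%:E)%E; last first.
  rewrite integral_indic//; congr (mu _).
  by apply/seteqP; split => x /=; [move=> ->; split => //; rewrite in_itv/= ler01 lexx|case].
under eq_cvg => m.
  rewrite restr; last 2 first.
  - by apply/measurable_EFinP; exact: measurable_powR.
  - by move=> x; rewrite lee_fin powR_ge0.
  over.
have [|||||_ _] := @dominated_convergence _ _ _ mu _ m01 (fun m x => (x `^ m%:R)%:E)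
  (fun x => (\1_[set 1%R] x)%:E) (cst 1%E); last exact.
- by move=> m; apply/measurable_EFinP; apply: measurable_funTS; exact: measurable_powR.
- by apply/measurable_EFinP; exact: measurable_indic.
- apply/aeW => x /=; rewrite in_itv/= => /andP[x0 x1].
  apply: cvg_EFin; first exact: nearW.
  apply: (@cvg_trans _ (x ^+ m @[m --> \oo])).
    by apply: near_eq_cvg; apply: nearW => m /=; rewrite powR_mulrn.
  rewrite indicE; case: (eqVneq x 1) => [->|xn1].
    rewrite mem_set//; under eq_cvg do rewrite expr1n; exact: cvg_cst.
  rewrite memNset ?mulr0n; last by move/eqP; rewrite (negbTE xn1).
  by apply: cvg_expr; rewrite ger0_norm// lt_neqAle xn1.
- exact: finite_measure_integrable_cst.
- apply/aeW => x m /=; rewrite in_itv/= => /andP[x0 x1].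
  by rewrite lee_fin ger0_norm ?powR_ge0// powR_mulrn// exprn_ile1.
Qed.

(** A Markov-type inequality: x^m is at least r0^m >= 1/2 on [r0, 1[ and equals 1 at 1. *)
Lemma integral_powR_tail (m : nat) (r0 : R) : 0 <= r0 -> 2^-1 <= r0 ^+ m ->
  (2^-1%:E * mu `[r0, 1%R[%classic + mu [set 1%R] <= \int[mu]_x (x `^ m%:R)%:E)%E.
Proof.
move=> r00 r0m.
have mI : measurable (`[r0, 1[%classic : set (measurableTypeR R)) by exact: measurable_itv.
rewrite (_ : (_ + _)%E = \int[mu]_x (2^-1%:E * (\1_`[r0, 1%R[ x)%:E +
    (\1_[set 1%R] x)%:E))%E; last first.
  rewrite ge0_integralD//=.
  - rewrite ge0_integralZl_EFin; last 4 first.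
    + exact: measurableT.
    + by move=> x _; rewrite lee_fin.
    + by apply/measurable_EFinP; exact: measurable_indic.
    + by rewrite invr_ge0.
    rewrite (integral_indic mu measurableT mI) setIT.
    by rewrite (integral_indic mu measurableT (measurable_set1 1)) setIT.
  - exact/measurable_funeM/measurable_EFinP/measurable_indic.
  - by apply/measurable_EFinP; exact: measurable_indic.
apply: ge0_le_integral => //=.
- by move=> x _; rewrite -EFinM lee_fin addr_ge0// mulr_ge0 ?invr_ge0.
- apply: emeasurable_funD; last by apply/measurable_EFinP; exact: measurable_indic.
  exact/measurable_funeM/measurable_EFinP/measurable_indic.
- by apply/measurable_EFinP; exact: measurable_powR.
move=> x _; rewrite -EFinM lee_fin !indicE.
case: (eqVneq x 1) => [->|xn1].
  by rewrite memNset /= ?in_itv/= ?ltxx ?andbF// mulr0 add0r powR1 mem_set.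
rewrite (memNset (A := [set 1])); last by move/eqP; rewrite (negbTE xn1).
rewrite addr0; case: (boolP (x \in `[r0, 1[)) => xi; last first.
  by rewrite memNset ?mulr0 ?powR_ge0//; exact/negP.
rewrite mem_set// mulr1; move: xi; rewrite in_itv/= => /andP[rx x1].
by rewrite powR_mulrn ?(le_trans r00)// (le_trans r0m)// lerXn2r// nnegrE (le_trans r00).
Qed.

End moments.

(** * The atom of [G sigma] at 1 and the Laplace transform *)

Section laplace.
Variables (R : realType) (G : R -> probability (measurableTypeR R) R) (psi : R -> R).
Hypotheses (G01 : forall sigma : R, 1 <= sigma -> G sigma `[0, 1]%classic = 1%E)
  (hpsi : has_laplace_exponent G psi).

Lemma laplace_cvg_atom (sigma : R) : 1 <= sigma ->
  (sigma `^ (- psi m%:R))%:E @[m --> \oo] --> G sigma [set 1].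
Proof.
move=> s1; apply: cvg_trans (integral_powR_cvg (G01 s1)); apply: near_eq_cvg.
near=> m; rewrite -hpsi// ?unlock// ltr0n; near: m; exact: nbhs_infty_gt.
Unshelve. all: by end_near. Qed.

Lemma laplace_cvg_fine_atom (sigma : R) : 1 <= sigma ->
  sigma `^ (- psi m%:R) @[m --> \oo] --> fine (G sigma [set 1]).
Proof.
move=> s1; have := laplace_cvg_atom s1.
have -> : G sigma [set 1] = (fine (G sigma [set 1]))%:E by rewrite fineK ?fin_num_measure.
by move=> /fine_cvg.
Qed.

Lemma laplaceX (sigma : R) n m : 1 <= sigma ->
  (sigma ^+ n) `^ (- psi m%:R) = (sigma `^ (- psi m%:R)) ^+ n.
Proof.
move=> s1; have s0 : 0 <= sigma by rewrite (le_trans _ s1).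
rewrite -(powR_mulrn n s0) -(powR_mulrn n (powR_ge0 sigma (- psi m%:R))).
by rewrite -!powRrM mulrC.
Qed.

(** The power law holds exactly for every moment sigma^(-psi(m)), and passes to the limit m -> oo,
    where the moments tend to the atom. *)
Lemma atomX (sigma : R) n : 1 <= sigma ->
  fine (G (sigma ^+ n) [set 1]) = fine (G sigma [set 1]) ^+ n.
Proof.
move=> s1.
have := laplace_cvg_fine_atom (exprn_ege1 n s1).
under eq_cvg do rewrite laplaceX//.
move=> c1.
have c2 := cvg_comp _ _ (laplace_cvg_fine_atom s1) (@exprn_continuous R n _).
exact: (cvg_unique _ c1 c2).
Qed.

Lemma laplace_tail (sigma r0 : R) m :
  1 <= sigma -> (0 < m)%N -> 0 <= r0 -> 2^-1 <= r0 ^+ m ->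
  fine (G sigma `[r0, 1[%classic) <= 2 * (sigma `^ (- psi m%:R) - fine (G sigma [set 1])).
Proof.
move=> s1 m0 r00 r0m.
have mI : measurable (`[r0, 1[%classic : set (measurableTypeR R)) by exact: measurable_itv.
have := integral_powR_tail (G sigma) r00 r0m.
have := hpsi s1 (_ : 0 < m%:R); rewrite ltr0n unlock => -> //.
rewrite -(fineK (fin_num_measure (G sigma) _ mI)).
rewrite -(fineK (fin_num_measure (G sigma) _ (measurable_set1 1))).
by rewrite -EFinM -EFinD lee_fin; lra.
Qed.

Lemma atom_le_laplace (sigma : R) m : 1 <= sigma -> (0 < m)%N ->
  fine (G sigma [set 1]) <= sigma `^ (- psi m%:R).
Proof.
move=> s1 m0.
(* For r0 = 1 the interval [r0, 1[ is empty, and the tail bound reduces to nonnegativity of its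
   right-hand side. *)
have := @laplace_tail sigma 1 m s1 m0 ler01; rewrite expr1n.
rewrite invf_le1// ler1n => /(_ isT); rewrite set_itvco0// measure0 /=; lra.
Qed.

End laplace.

(** * Gaussian densities and their mixtures *)

Lemma measurable_normal_density d (T : measurableType d) (R : realType) (m v y : T -> R) :
  measurable_fun setT m -> measurable_fun setT v -> measurable_fun setT y ->
  measurable_fun setT (fun z => normal_peak (v z) * normal_fun (m z) (v z) (y z)).
Proof.
move=> mm mv my; apply: measurable_funM.
  (* Inverses are rewritten as powers of exponent -1, to which [measurable_powR] applies. *)
  rewrite /normal_peak (_ : (fun z => _) =
      (fun z => (Num.sqrt (v z ^+ 2 * pi *+ 2)) `^ (-1))); last first.
    by apply/funext => z; rewrite powR_inv1// sqrtr_ge0.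
  apply: (measurableT_comp (measurable_powR (-1))).
  apply: (@measurableT_comp _ _ _ _ _ _ (@Num.sqrt R)).
    by apply: nondecreasing_measurable => // p q pq; exact: ler_wsqrtr.
  under eq_fun do rewrite mulr2n.
  have h : measurable_fun setT (fun z => v z ^+ 2 * pi).
    by apply: measurable_funM => //; exact: measurable_funX.
  exact: measurable_funD.
rewrite /normal_fun (_ : (fun z => _) =
    expR \o (fun z => - (y z - m z) ^+ 2 * (v z ^+ 2 *+ 2) `^ (-1))); last first.
  by apply/funext => z /=; rewrite powR_inv1// mulrn_wge0// sqr_ge0.
apply: measurableT_comp => //; apply: measurable_funM.
  by apply: measurableT_comp => //; apply: measurable_funX; exact: measurable_funB.
apply: (measurableT_comp (measurable_powR (-1))).
under eq_fun do rewrite mulr2n.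
by apply: measurable_funD; exact: measurable_funX.
Qed.

Lemma ler_normal_peak (R : realType) (v w : R) :
  0 < v -> v <= w -> normal_peak w <= normal_peak v.
Proof.
move=> v0 vw; have w0 := lt_le_trans v0 vw.
have pos (z : R) : 0 < z -> 0 < z ^+ 2 * pi *+ 2.
  by move=> z0; rewrite mulrn_wgt0// mulr_gt0 ?pi_gt0// exprn_gt0.
rewrite /normal_peak lef_pV2 ?posrE ?sqrtr_gt0 ?pos//.
apply: ler_wsqrtr; rewrite ler_wMn2r// ler_wpM2r// ?pi_ge0// lerXn2r// nnegrE ltW//.
Qed.

Section gaussian_mixture.
Variables (R : realType) (mu : probability (measurableTypeR R) R) (c x t : R).
Hypothesis t0 : 0 < t.

Let mean r := c * Num.sqrt r * x.
Let dev r := Num.sqrt (t * (1 - r)).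
(** The Gaussian density without the case split on a zero deviation, hence jointly measurable
    everywhere; it is identified with [gauss_density] only for r < 1, the range of the mixture. *)
Let h (z : measurableTypeR R * measurableTypeR R) :=
  normal_peak (dev z.2) * normal_fun (mean z.2) (dev z.2) z.1.

Let dev_gt0 r : r < 1 -> 0 < dev r.
Proof. by move=> r1; rewrite sqrtr_gt0 mulr_gt0// subr_gt0. Qed.

Let hE r y : r < 1 -> gauss_density (mean r) (t * (1 - r)) y = h (y, r).
Proof. by move=> /dev_gt0 d0; rewrite /gauss_density normal_pdfE// gt_eqF. Qed.

Let h_ge0 z : 0 <= h z.
Proof. by rewrite mulr_ge0 ?normal_peak_ge0// expR_ge0. Qed.

Let mh : measurable_fun setT h.
Proof.
have ms : measurable_fun setT (@Num.sqrt R).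
  by apply: nondecreasing_measurable => // p q pq; exact: ler_wsqrtr.
apply: measurable_normal_density.
- apply: measurable_funM; last exact: measurable_cst.
  apply: measurable_funM; first exact: measurable_cst.
  exact: (measurableT_comp ms measurable_snd).
- apply: (measurableT_comp ms); apply: measurable_funM; first exact: measurable_cst.
  by apply: measurable_funB; [exact: measurable_cst|exact: measurable_snd].
- exact: measurable_fst.
Qed.

Let inner (r0 y : R) := (\int[mu]_(r in `[r0, 1%R[) (h (y, r))%:E)%E.

Let mitv (r0 : R) : measurable (`[r0, 1[%classic : set (measurableTypeR R)).
Proof. exact: measurable_itv. Qed.

Let hind (r0 : R) (z : measurableTypeR R * measurableTypeR R) :=
  (h z * \1_(`[r0, 1[%classic : set (measurableTypeR R)) z.2)%:E.

Let hind_ge0 r0 z : (0 <= hind r0 z)%E.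
Proof. by rewrite lee_fin mulr_ge0// h_ge0. Qed.

Let mhind r0 : measurable_fun setT (hind r0).
Proof.
apply/measurable_EFinP; apply: measurable_funM; first exact: mh.
apply: (@measurableT_comp _ _ _ _ _ _ (\1_(`[r0, 1[%classic : set (measurableTypeR R))
  : measurableTypeR R -> R) _ (@snd (measurableTypeR R) (measurableTypeR R))).
  exact: measurable_indic.
exact: measurable_snd.
Qed.

Let mhind1 r0 y : measurable_fun setT (fun r => hind r0 (y, r)).
Proof. exact: (measurableT_comp (mhind r0) (measurable_pair1 _)). Qed.

Let innerE r0 y : inner r0 y = (\int[mu]_r hind r0 (y, r))%E.
Proof.
rewrite /inner integral_mkcond; apply: eq_integral => r _.
rewrite /patch /hind /= indicE; case: ifPn => _; first by rewrite mulr1.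
by rewrite mulr0.
Qed.

Let inner_ge0 r0 y : (0 <= inner r0 y)%E.
Proof. by apply: integral_ge0 => r _; rewrite lee_fin h_ge0. Qed.

Let minner r0 : measurable_fun (setT : set (measurableTypeR R)) (inner r0).
Proof.
rewrite (_ : inner r0 = fubini_F mu (hind r0)); last first.
  by apply/funext => y; exact: innerE.
exact: (measurable_fun_fubini_tonelli_F (m2 := mu)).
Qed.

(** Tonelli: integrated first in [y], each Gaussian has total mass 1. *)
Let integral_inner r0 : (\int[lebesgue_measure]_y inner r0 y = mu `[r0, 1%R[%classic)%E.
Proof.
under eq_integral do rewrite innerE.
rewrite (fubini_tonelli (m1 := lebesgue_measure) (m2 := mu) (hind r0)); last 2 first.
- exact: mhind.
- exact: hind_ge0.
rewrite -[X in _ = mu X]setIT -(integral_indic mu measurableT (mitv r0)).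
apply: eq_integral => r _; rewrite /hind /= indicE.
case: (boolP (r \in _)) => ri.
  have r1 : r < 1 by move: ri; rewrite inE/= in_itv/= => /andP[].
  under eq_integral do rewrite mulr1 -hE//.
  exact: integral_normal_pdf.
by under eq_integral do rewrite mulr0; rewrite integral0.
Qed.

(** For r < r0 the variance is at least t (1 - r0), so the density is below a fixed peak. For r in
    [r0, 1[ the density may be arbitrarily concentrated, and only its total mass is used. Keeping
    the factor [mu [0, 1[] matters: it becomes 1 - gamma, which is small for ratios close to 1. *)
Lemma gaussian_mixture_le (B : set (measurableTypeR R)) (l r0 : R) : measurable B ->
  lebesgue_measure B = l%:E -> 0 <= r0 -> r0 < 1 ->
  (\int[lebesgue_measure]_(y in B) \int[mu]_(r in `[0%R, 1%R[)
     (gauss_density (c * Num.sqrt r * x) (t * (1 - r)) y)%:E <=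
   (l * normal_peak (Num.sqrt (t * (1 - r0))))%:E * mu `[0%R, 1%R[%classic + mu `[r0, 1%R[%classic)%E.
Proof.
move=> mB lB r00 r01.
set K := normal_peak _.
have K0 : 0 <= K by exact: normal_peak_ge0.
under eq_integral => y _.
  rewrite (_ : (\int[mu]_(r in _) _)%E = inner 0 y); last first.
    by apply: eq_integral => r; rewrite inE/= in_itv/= => /andP[_ r1]; rewrite -hE.
  over.
rewrite -integral_inner.
pose k := (K%:E * mu `[0%R, 1%R[%classic)%E.
have k0 : (0 <= k)%E by rewrite mule_ge0.
apply: (@le_trans _ _ (\int[lebesgue_measure]_(y in B) (k + inner r0 y))%E).
  apply: ge0_le_integral.
  - exact: mB.
  - by [].
  - exact: measurable_funTS.
  - apply: emeasurable_funD; first exact: measurable_cst.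
    exact: measurable_funTS.
  move=> y _; rewrite /k !innerE -[`[0, 1[%classic]setIT.
  rewrite -(integral_indic mu measurableT (mitv 0)).
  have mi : measurable_fun setT (fun r : measurableTypeR R =>
      (\1_(`[0%R, 1%R[%classic : set (measurableTypeR R)) r : R)%:E).
    by exact/measurable_EFinP/measurable_indic.
  rewrite -ge0_integralZl_EFin; last 4 first.
  - exact: measurableT.
  - by move=> r _; rewrite lee_fin.
  - exact: mi.
  - exact: K0.
  rewrite -ge0_integralD; last 5 first.
  - exact: measurableT.
  - by move=> r _; rewrite mule_ge0 ?lee_fin.
  - exact: measurable_funeM.
  - by move=> r _; exact: hind_ge0.
  - exact: mhind1.
  apply: ge0_le_integral.
  - exact: measurableT.
  - by move=> r _; exact: hind_ge0.
  - exact: mhind1.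
  - by apply: emeasurable_funD; [exact: measurable_funeM|exact: mhind1].
  move=> r _; rewrite /hind /= !indicE -EFinM -EFinD lee_fin.
  case: (boolP (r \in `[0, 1[%classic)) => ri; last first.
    by rewrite !mulr0 add0r mulr_ge0// h_ge0.
  rewrite !mulr1; case: (boolP (r \in `[r0, 1[%classic)) => rj.
    by rewrite mulr1 lerDr.
  rewrite mulr0 addr0.
  move: ri; rewrite inE/= in_itv/= => /andP[rge0 r1].
  move: rj; rewrite notin_setE/= in_itv/= r1 andbT => /negP; rewrite -ltNge => rr0.
  rewrite -hE// (le_trans (normal_pdf_ub _ _ _))//; first by rewrite gt_eqF// dev_gt0.
  apply: ler_normal_peak; first by rewrite sqrtr_gt0 mulr_gt0// subr_gt0.
  by apply: ler_wsqrtr; apply: ler_wpM2l; [exact: ltW|lra].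
rewrite ge0_integralD; last 5 first.
- exact: mB.
- by [].
- exact: measurable_cst.
- by [].
- exact: measurable_funTS.
apply: leeD; last first.
  by apply: ge0_subset_integral => //; exact: measurableT.
rewrite (integral_cst lebesgue_measure mB) [X in (_ * X)%E]lB /k EFinM.
by rewrite -!muleA [leRHS]muleC muleA.
Qed.

End gaussian_mixture.

(** * Partitions and the natural filtration *)

(** By countable additivity, a bound on conditional probabilities may be checked on the cells of a
    partition, on each of which the starting point of a step is nearly constant. *)
Lemma measure_partition_le d (T : measurableType d) (R : realType)
    (P : {measure set T -> \bar R}) (C : (set T)^nat) (A B : set T) (a b : R) :
  0 <= a -> 0 <= b -> (forall n, measurable (C n)) -> trivIset setT C -> \bigcup_n C n = setT ->
  measurable A -> measurable B ->
  (forall n, a%:E * P (A `&` C n) <= b%:E * P (B `&` C n))%E ->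
  (a%:E * P A <= b%:E * P B)%E.
Proof.
move=> a0 b0 mC tC CT mA mB le_cell.
have split_sum D : measurable D -> P D = (\sum_(n <oo) P (D `&` C n))%E.
  move=> mD; rewrite -{1}(setIT D) -CT setI_bigcupr measure_bigcup//.
  - by apply: eq_eseriesl => i; rewrite in_setT.
  - by move=> n _; exact: measurableI.
  - exact: trivIset_setIl.
rewrite (split_sum A)// (split_sum B)// -!nneseriesZl//.
by apply: lee_nneseries => // n _; rewrite mule_ge0.
Qed.

Section natural_filtration.
Context d (T : measurableType d) (R : realType) (P : probability T R)
  (X : R -> {RV P >-> R}).

Lemma natural_filtration_measurable s A : natural_filtration X s A -> measurable A.
Proof.
move: A; apply: smallest_sub; first exact: sigma_algebra_measurable.
by move=> A [u [B [_ _ mB ->]]]; rewrite -[X in measurable X]setTI; exact: measurable_funP.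
Qed.

Lemma sub_natural_filtration s t : s <= t -> natural_filtration X s `<=` natural_filtration X t.
Proof.
move=> st; apply: sub_sigma_algebra2 => A [u [B [u0 us mB ->]]].
by exists u, B; split => //; exact: le_trans st.
Qed.

Lemma natural_filtrationI s A B : natural_filtration X s A ->
  natural_filtration X s B -> natural_filtration X s (A `&` B).
Proof.
exact: (@measurableI _ (g_sigma_algebraType [set A | exists (u : R) (B : set R),
         [/\ 0 <= u, u <= s, measurable B & A = X u @^-1` B]])).
Qed.

Lemma natural_filtrationT s : natural_filtration X s setT.
Proof.
exact: (@measurableT _ (g_sigma_algebraType [set A | exists (u : R) (B : set R),
         [/\ 0 <= u, u <= s, measurable B & A = X u @^-1` B]])).
Qed.

Lemma natural_filtration_preimage s u B : 0 <= u -> u <= s -> measurable B ->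
  natural_filtration X s (X u @^-1` B).
Proof. by move=> u0 us mB; apply: sub_sigma_algebra; exists u, B. Qed.

Lemma natural_filtration_increment s u v (c : R) B : 0 <= u -> u <= s -> 0 <= v -> v <= s ->
  measurable B -> natural_filtration X s ((fun w => X u w - c * X v w) @^-1` B).
Proof.
move=> u0 us v0 vs mB.
(* [Ts] is [T] with the natural filtration at time [s] as its measurable sets, so that membership
   follows from measurability of functions. *)
pose Ts := g_sigma_algebraType [set A | exists (u : R) (B : set R),
         [/\ 0 <= u, u <= s, measurable B & A = X u @^-1` B]].
have mX z : 0 <= z -> z <= s -> measurable_fun (setT : set Ts) (X z : Ts -> R).
  by move=> z0 zs _ Y mY; rewrite setTI; exact: natural_filtration_preimage.
have mD : measurable_fun (setT : set Ts) (fun w : Ts => X u w - c * X v w).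
  by apply: measurable_funB; [exact: mX|apply: measurable_funM => //; exact: mX].
by have := mD measurableT _ mB; rewrite setTI.
Qed.

End natural_filtration.

(** * One Markov step between times [s] and [t] *)

Section markov_step.
Context d (T : measurableType d) (R : realType) (P : probability T R)
  (X : R -> {RV P >-> R}) (G : R -> probability (measurableTypeR R) R).
Hypothesis markovX : markov_with_transition X (transition G).
Variables (s t : R).
Hypotheses (s0 : 0 < s) (st : s < t).

Let sigma := Num.sqrt (t / s).
Let t0 : 0 < t := lt_trans s0 st.

Lemma markov_probability E B : natural_filtration X s E -> measurable B ->
  P (E `&` X t @^-1` B) = (\int[P]_(w in E) transition G s t (X s w) B)%E.
Proof.
move=> FE mB; have mE := natural_filtration_measurable FE.
have [_ ->//] := markovX (ltW s0) st mB.
rewrite integral_indic// 1?setIC//.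
by rewrite -[X in measurable X]setTI; exact: measurable_funP.
Qed.

Lemma transition_ge_atom x B : (sigma * x) \in B ->
  (G sigma [set 1%R] <= transition G s t x B)%E.
Proof.
move=> xB; rewrite /transition gt_eqF// -/sigma diracE xB mule1 leeDl//.
apply: integral_ge0 => y _; apply: integral_ge0 => r _.
by rewrite lee_fin normal_pdf_ge0.
Qed.

Lemma transition_le x (B : set (measurableTypeR R)) (l r0 : R) : measurable B ->
  lebesgue_measure B = l%:E -> 0 <= r0 -> r0 < 1 ->
  (transition G s t x B <= G sigma [set 1%R] +
   ((l * normal_peak (Num.sqrt (t * (1 - r0))))%:E * G sigma `[0%R, 1%R[%classic +
    G sigma `[r0, 1%R[%classic))%E.
Proof.
move=> mB lB r00 r01; rewrite /transition gt_eqF// -/sigma.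
apply: leeD; last exact: gaussian_mixture_le.
by rewrite -[leRHS]mule1 lee_pmul// diracE lee_fin; case: (_ \in _).
Qed.

(** Obtained from the definition of a conditional expectation rather than from the formula of the
    kernel. *)
Lemma measurable_transition E B : natural_filtration X s E -> measurable B ->
  measurable_fun E (fun w => transition G s t (X s w) B).
Proof.
move=> FE mB; have [h _] := markovX (ltW s0) st mB.
apply: measurable_funTS => _ Y mY; rewrite setTI.
by apply: natural_filtration_measurable; exact: h mY.
Qed.

Lemma transition_ge0 x B : (0 <= transition G s t x B)%E.
Proof.
rewrite /transition gt_eqF// adde_ge0// ?mule_ge0//.
apply: integral_ge0 => y _; apply: integral_ge0 => r _.
by rewrite lee_fin normal_pdf_ge0.
Qed.

Variable e : R.
Hypothesis e0 : 0 < e.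

(** The Markov property concerns events on X_t alone, whereas [near_event] involves X_s too. On a
    cell, sigma X_s stays in one interval of length e, so [near_event] can be compared with a fixed
    interval for X_t. [pickle] turns the integer labels into natural ones; some cells may be
    empty. *)
Let cell n : set R := [set x | pickle (Num.floor (sigma * x / e)) = n].

Let cellE n x : cell n x ->
  exists z : int, cell n = [set y | z%:~R * e <= sigma * y < (z + 1)%:~R * e].
Proof.
move=> cx; exists (Num.floor (sigma * x / e)); apply/seteqP; split => y /=.
  rewrite /cell /= => yn; have -> : Num.floor (sigma * x / e) = Num.floor (sigma * y / e).
    by apply: (pcan_inj (@pickleK int)); rewrite yn.
  by rewrite -ler_pdivlMr// -ltr_pdivrMr// floor_itv.
rewrite -ler_pdivlMr// -ltr_pdivrMr// => /andP[zy yz].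
by rewrite /cell /= -cx; congr pickle; apply: floor_def; rewrite zy.
Qed.

Let mcell n : measurable (cell n).
Proof.
have [->|/set0P[x /cellE[z ->]]] := eqVneq (cell n) set0; first exact: measurable0.
rewrite (_ : [set y | _] = ( *%R sigma) @^-1` [set` `[z%:~R * e, (z + 1)%:~R * e[]); last first.
  by apply/seteqP; split => y /=; rewrite in_itv.
rewrite -[X in measurable X]setTI; apply: measurable_funM => //; exact: measurable_itv.
Qed.

Let cellT : \bigcup_n cell n = setT.
Proof. by apply/seteqP; split => // x _; exists (pickle (Num.floor (sigma * x / e))). Qed.

Let tcell : trivIset setT cell.
Proof.
apply/trivIsetP => i j _ _ ij; apply/seteqP; split => // x [/= xi xj].
by move: ij; rewrite -xi -xj eqxx.
Qed.

Let D w := X t w - sigma * X s w.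
Let near_event := [set w | `|D w| < e].

Lemma measurable_near_event : measurable near_event.
Proof.
apply: (@natural_filtration_measurable _ _ _ P X t).
rewrite (_ : near_event = D @^-1` [set y | `|y| < e])//.
apply: natural_filtration_increment => //; [exact: ltW|exact: ltW|exact: ltW|].
rewrite (_ : [set y | _] = [set` `]-e, e[]); first exact: measurable_itv.
by apply/seteqP; split => y /=; rewrite in_itv/= ltr_norml.
Qed.

(** On a cell, X_t and sigma X_s in the same interval of length e differ by less than e, and this
    interval carries the atom of the kernel at sigma X_s. *)
Lemma near_event_ge E : natural_filtration X s E ->
  (G sigma [set 1%R] * P E <= P (E `&` near_event))%E.
Proof.
move=> FE; have mE := natural_filtration_measurable FE.
have mN := measurable_near_event.
rewrite -[leRHS]mul1e -[G _ _]fineK ?fin_num_measure//.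
have FC n : natural_filtration X s (X s @^-1` cell n).
  by apply: natural_filtration_preimage => //; exact: ltW.
apply: (@measure_partition_le _ _ _ _ (fun n => X s @^-1` cell n)) => //.
- by rewrite fine_ge0.
- by move=> n; exact: natural_filtration_measurable (FC n).
- apply/trivIsetP => i j _ _ ij.
  by rewrite -preimage_setI ((iffLR trivIsetP tcell) i j)// preimage_set0.
- by rewrite -preimage_bigcup cellT preimage_setT.
- exact: measurableI.
move=> n; rewrite mul1e fineK ?fin_num_measure//.
have FEn := natural_filtrationI FE (FC n).
have mEn := natural_filtration_measurable FEn.
have [->|/set0P[w0 [_ w0n]]] := eqVneq (E `&` X s @^-1` cell n) set0.
  by rewrite measure0 mule0.
have [z cnE] := cellE w0n.
pose I := [set` `[z%:~R * e, (z + 1)%:~R * e[].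
have mI : measurable I by exact: measurable_itv.
apply: (@le_trans _ _ (P ((E `&` X s @^-1` cell n) `&` X t @^-1` I))); last first.
  apply: le_measure; rewrite ?inE.
  - by apply: measurableI => //; rewrite -[X in measurable X]setTI; exact: measurable_funP.
  - by apply: measurableI; [exact: measurableI|exact: natural_filtration_measurable (FC n)].
  move=> w [[Ew cw] tw]; split=> //; split=> //.
  move: cw tw; rewrite /= cnE /I /near_event /= in_itv /= /D intrD mulrDl mul1r ltr_norml.
  by move=> /andP[? ?] /andP[? ?]; apply/andP; split; lra.
rewrite markov_probability// -integral_cst//.
apply: ge0_le_integral => //.
- exact: measurable_transition.
move=> w [_ /=]; rewrite cnE /= => cw; apply: transition_ge_atom.
by rewrite inE /I /= in_itv.
Qed.

(** On a cell, [near_event] forces X_t into the interval of the cell enlarged by e on both sides: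
    hence the length 3e. *)
Lemma near_event_le E (r0 : R) : natural_filtration X s E -> 0 <= r0 -> r0 < 1 ->
  (P (E `&` near_event) <= (G sigma [set 1%R] +
   ((3 * e * normal_peak (Num.sqrt (t * (1 - r0))))%:E * G sigma `[0%R, 1%R[%classic +
    G sigma `[r0, 1%R[%classic)) * P E)%E.
Proof.
move=> FE r00 r01; have mE := natural_filtration_measurable FE.
have mN := measurable_near_event.
have m1 r : measurable (`[r, 1[%classic : set (measurableTypeR R)) by exact: measurable_itv.
have pk0 r : 0 <= normal_peak r :> R by exact: normal_peak_ge0.
set c := (_ + _)%E.
have c0 : (0 <= c)%E by rewrite !adde_ge0// mule_ge0// lee_fin !mulr_ge0// ltW.
have cfin : c \is a fin_num.
  by rewrite !(fin_numD, fin_numM)// !fin_num_measure.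
rewrite -[leLHS]mul1e -(fineK cfin).
have FC n : natural_filtration X s (X s @^-1` cell n).
  by apply: natural_filtration_preimage => //; exact: ltW.
apply: (@measure_partition_le _ _ _ _ (fun n => X s @^-1` cell n)) => //.
- by rewrite fine_ge0.
- by move=> n; exact: natural_filtration_measurable (FC n).
- apply/trivIsetP => i j _ _ ij.
  by rewrite -preimage_setI ((iffLR trivIsetP tcell) i j)// preimage_set0.
- by rewrite -preimage_bigcup cellT preimage_setT.
- exact: measurableI.
move=> n; rewrite mul1e fineK//.
have FEn := natural_filtrationI FE (FC n).
have mEn := natural_filtration_measurable FEn.
have [E0|/set0P[w0 [_ w0n]]] := eqVneq (E `&` X s @^-1` cell n) set0.
  by rewrite setIAC E0 set0I measure0 mule0.
have [z cnE] := cellE w0n.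
pose J := [set` `]z%:~R * e - e, (z + 1)%:~R * e + e[].
have mJ : measurable J by exact: measurable_itv.
have lJ : lebesgue_measure J = (3 * e)%:E.
  rewrite lebesgue_measure_itv /= lte_fin intrD mulrDl mul1r ifT; last first.
    by rewrite -!addrA ltrD2l (@lt_trans _ _ 0) ?oppr_lt0 ?addr_gt0.
  by rewrite -EFinD; congr EFin; ring.
apply: (@le_trans _ _ (P ((E `&` X s @^-1` cell n) `&` X t @^-1` J))).
  apply: le_measure; rewrite ?inE.
  - by apply: measurableI; [exact: measurableI|exact: natural_filtration_measurable (FC n)].
  - by apply: measurableI => //; rewrite -[X in measurable X]setTI; exact: measurable_funP.
  move=> w [[Ew Dw] cw]; split=> //.
  move: cw Dw; rewrite /= cnE /J /near_event /= in_itv /= /D intrD mulrDl mul1r ltr_norml.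
  by move=> /andP[? ?] /andP[? ?]; apply/andP; split; lra.
rewrite markov_probability// -integral_cst//.
apply: ge0_le_integral => //.
- by move=> w _; exact: transition_ge0.
- exact: measurable_transition.
by move=> w [_ /=] _; exact: transition_le.
Qed.

End markov_step.

(** The lower bound of [near_event_ge] does not depend on e, so it survives the decreasing limit e =
    1/(j+1). *)
Lemma exact_step_ge d (T : measurableType d) (R : realType) (P : probability T R)
    (X : R -> {RV P >-> R}) (G : R -> probability (measurableTypeR R) R) (s t : R) E :
  markov_with_transition X (transition G) -> 0 < s -> s < t -> natural_filtration X s E ->
  (G (Num.sqrt (t / s)) [set 1%R] * P E <=
   P (E `&` [set w | (X t w - Num.sqrt (t / s) * X s w = 0)%R]))%E.
Proof.
move=> mX s0 st FE; have mE := natural_filtration_measurable FE.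
set sigma := Num.sqrt _.
pose N j := E `&` [set w | `|X t w - sigma * X s w| < j.+1%:R^-1].
have mN j : measurable (N j) by apply: measurableI => //; exact: measurable_near_event.
have -> : E `&` [set w | X t w - sigma * X s w = 0] = \bigcap_j N j.
  apply/seteqP; split => [w [Ew /= D0] j _|w Nw].
    by split => //=; rewrite D0 normr0 invr_gt0.
  split; first by case: (Nw 0%N).
  apply/eqP; rewrite /= -normr_le0; apply/ler_addgt0Pl => e e0; rewrite addr0.
  have [k ke] := ltr_add_invr e0; rewrite add0r in ke.
  by have [_ /= h] := Nw k I; rewrite ltW// (lt_trans h).
have cvgN : P (N j) @[j --> \oo] --> P (\bigcap_j N j).
  apply: nonincreasing_cvg_mu => //.
  - by rewrite ltey_eq fin_num_measure.
  - exact: bigcapT_measurable.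
  - move=> i j ij; apply/subsetPset => w [Ew /= Dw]; split => //=.
    by rewrite (lt_le_trans Dw)// lef_pV2 ?posrE// ler_nat.
rewrite -(cvg_lim _ cvgN)//; apply: lime_ge; first by apply/cvg_ex; eexists; exact: cvgN.
by apply: nearW => j; exact: near_event_ge.
Qed.

(** * Probability of having no jump in ]s, s rho^2] *)

Section no_jump.
Context (R : realType) (G : R -> probability (measurableTypeR R) R) (psi : R -> R).
Hypothesis G01 : forall sigma : R, 1 <= sigma -> G sigma `[0, 1]%classic = 1%E.
Hypothesis laplaceG : has_laplace_exponent G psi.
Hypothesis atom_gt0 : forall sigma : R, 1 <= sigma -> (0 < G sigma [set 1%R])%E.

Let atom sigma := fine (G sigma [set 1]).

Let atomE sigma : (atom sigma)%:E = G sigma [set 1].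
Proof. by rewrite fineK ?fin_num_measure. Qed.

Let atom_pos sigma : 1 <= sigma -> 0 < atom sigma.
Proof. by move=> /atom_gt0; rewrite -atomE lte_fin. Qed.

Let atom_le1 sigma : atom sigma <= 1.
Proof. by rewrite -lee_fin atomE probability_le1. Qed.

Lemma measure_Ico01 sigma : 1 <= sigma -> G sigma `[0%R, 1%R[%classic = (1 - atom sigma)%:E.
Proof.
move=> s1.
have mI : measurable (`[0, 1[%classic : set (measurableTypeR R)) by exact: measurable_itv.
have := G01 s1; rewrite -(@setUitv1 _ _ (BLeft 0) 1 true) ?bnd_simp// measureU//; last first.
  by apply/seteqP; split => // x [/= ] /[swap] ->; rewrite in_itv/= ltxx andbF.
by move=> h; rewrite EFinB -h atomE addeK// fin_num_measure.
Qed.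

(** A quantitative right-continuity of gamma at [rho]. With q the atom of the 2^k-th root,
    [exprn_sub_ge] at p = 1 gives q^(2^k) 2^k (1 - q) <= 1, where q^(2^k) is the atom at [rho] and
    2^k >= k + 1. *)
Lemma iter_sqrt_atom_gap (rho : R) k : 1 < rho ->
  atom rho <= atom rho * atom (iter k Num.sqrt rho) + k.+1%:R^-1.
Proof.
move=> rho1; have r1 := ltW (iter_sqrt_gt1 k rho1).
have rho0 : 0 <= rho by rewrite (le_trans _ (ltW rho1)).
have := @exprn_sub_ge _ 1 (atom (iter k Num.sqrt rho)) (2 ^ k)
  (ltW (atom_pos r1)) (atom_le1 _) (atom_le1 _).
rewrite expr1n /atom -(atomX G01 laplaceG (2 ^ k) r1) iter_sqrtXn// -!/(atom _).
set b := atom rho; set q := atom (iter _ _ _) => h.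
have b0 : 0 <= b by rewrite ltW// atom_pos// ltW.
have k2 : (k.+1%:R : R) <= (2 ^ k)%:R by rewrite ler_nat; exact: ltn_expl.
have bq0 : 0 <= b * (1 - q) by rewrite mulr_ge0// subr_ge0 atom_le1.
have {}h : k.+1%:R * (b * (1 - q)) <= 1.
  have := ler_wpM2r bq0 k2; set n := (2 ^ k)%:R in h *; nra.
by rewrite -lerBlDl -[X in _ - X * _]mulr1 -[leRHS]mul1r ler_pdivlMr ?ltr0Sn//; lra.
Qed.

Context d (T : measurableType d) (P : probability T R) (X : R -> {RV P >-> R}).
Hypothesis markovX : markov_with_transition X (transition G).
Variables (s rho : R).
Hypotheses (s0 : 0 < s) (rho1 : 1 < rho).

Let rho0 : 0 <= rho. Proof. by rewrite (le_trans _ (ltW rho1)). Qed.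

Let r k := iter k Num.sqrt rho.
Let r_gt1 k : 1 < r k. Proof. exact: iter_sqrt_gt1. Qed.
Let r_ge1 k : 1 <= r k. Proof. exact: ltW. Qed.
Let rX k : r k ^+ (2 ^ k) = rho. Proof. exact: iter_sqrtXn. Qed.
Let D k i w := grid_increment (fun u => X u w) s rho k i.

(** The set [Q] is a parameter so that exact vanishing ({0}) and smallness (a ball) share the same
    induction along the grid. *)
Let ev (Q : set R) k m := [set w | forall i, (i < m)%N -> Q (D k i w)].

Let evS Q k m : ev Q k m.+1 = ev Q k m `&` (D k m @^-1` Q).
Proof.
apply/seteqP; split => [w h|w [h Qm] i].
  by split; [move=> i im|]; apply: h; rewrite ltnS// ltnW.
by rewrite ltnS leq_eqVlt => /predU1P[->//|]; exact: h.
Qed.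

Let ev_filtration Q k m : measurable Q -> natural_filtration X (grid s rho k m) (ev Q k m).
Proof.
move=> mQ; elim: m => [|m ih].
  rewrite (_ : ev Q k 0 = setT); first exact: natural_filtrationT.
  by apply/seteqP; split.
rewrite evS; apply: natural_filtrationI.
  by apply: sub_natural_filtration ih; rewrite ler_grid.
by apply: natural_filtration_increment => //; rewrite ?ler_grid// ltW// grid_gt0.
Qed.

Let mev Q k m : measurable Q -> measurable (ev Q k m).
Proof. by move=> mQ; exact: natural_filtration_measurable (@ev_filtration _ k m mQ). Qed.

(** What the geometric grid is for: every step has the same ratio, hence the same atom. *)
Let sqrt_grid k i : Num.sqrt (grid s rho k i.+1 / grid s rho k i) = r k.
Proof.
rewrite gridS mulfK ?gt_eqF ?grid_gt0// sqrtr_sqr ger0_norm//.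
by rewrite (le_trans _ (r_ge1 k)).
Qed.

Let grid_lt k i : grid s rho k i < grid s rho k i.+1.
Proof. by rewrite ltr_grid. Qed.

Lemma grid_exact_ge k m : ((atom (r k) ^+ m)%:E <= P (ev [set 0%R] k m))%E.
Proof.
elim: m => [|m ih].
  rewrite (_ : ev _ _ _ = setT) ?probability_setT ?expr0//.
  by apply/seteqP; split.
rewrite evS exprS EFinM.
apply: (@le_trans _ _ ((atom (r k))%:E * P (ev [set 0%R] k m))%E).
  by apply: lee_wpmul2l => //; rewrite lee_fin ltW// atom_pos.
have := exact_step_ge markovX (grid_gt0 s0 rho1 k m) (grid_lt k m)
  (@ev_filtration _ k m (measurable_set1 0)).
by rewrite sqrt_grid -atomE.
Qed.

(** With q the atom and eta the one-step error, the probabilities satisfy p_(m+1) <= (q + eta) p_m.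
    Since p_m <= 1 and q <= 1, the errors add up to at most m eta. *)
Lemma grid_near_le k m (e r0 : R) : 0 < e -> 0 <= r0 -> r0 < 1 ->
  (P (ev [set y | `|y| < e]%R k m) <=
   (atom (r k) ^+ m + m%:R * (3 * e * normal_peak (Num.sqrt (s * (1 - r0))) * (1 - atom (r k))
      + fine (G (r k) `[r0, 1%R[%classic)))%:E)%E.
Proof.
move=> e0 r00 r01.
have mB : measurable [set y : R | `|y| < e].
  rewrite (_ : [set y | _] = [set` `]-e, e[]); first exact: measurable_itv.
  by apply/seteqP; split => y /=; rewrite in_itv/= ltr_norml.
have mI : measurable (`[r0, 1[%classic : set (measurableTypeR R)) by exact: measurable_itv.
have q0 := atom_pos (r_ge1 k).
set eta := _ + fine _.
have eta0 : 0 <= eta.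
  by rewrite addr_ge0 ?fine_ge0// !mulr_ge0// ?(ltW e0) ?normal_peak_ge0// subr_ge0.
elim: m => [|m ih].
  by rewrite expr0 mul0r addr0 probability_le1//; exact: mev.
rewrite evS.
have := near_event_le markovX (grid_gt0 s0 rho1 k m) (grid_lt k m) e0
  (@ev_filtration _ k m mB) r00 r01.
rewrite sqrt_grid => /le_trans; apply.
have mE := @mev _ k m mB.
have P1 := probability_le1 P mE; move: ih P1.
rewrite -(fineK (fin_num_measure P _ mE)) !lee_fin => ih P1.
have u0 : 0 <= fine (P (ev [set y : R | `|y| < e] k m)) by rewrite fine_ge0.
apply: (@le_trans _ _ ((atom (r k) + eta)%:E *
  (fine (P (ev [set y : R | `|y| < e] k m)))%:E)%E).
  apply: lee_wpmul2r => //; rewrite EFinD; apply: leeD; first by rewrite atomE.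
  rewrite measure_Ico01// -(fineK (fin_num_measure (G (r k)) _ mI)) -EFinM -EFinD lee_fin.
  rewrite lerD2r ler_wpM2r ?subr_ge0// ler_wpM2l ?mulr_ge0 ?(ltW e0)//.
  (* The peak decreases with the variance and grid times are at least [s], so the constant at [s]
     serves every step. *)
  apply: ler_normal_peak; first by rewrite sqrtr_gt0 mulr_gt0// subr_gt0.
  by apply: ler_wsqrtr; rewrite ler_wpM2r ?subr_ge0 ?(ltW r01)// grid_ge.
rewrite -EFinM lee_fin exprS -natr1.
have := ler_wpM2l (ltW q0) ih.
have := ler_wpM2l eta0 P1.
have : atom (r k) * (m%:R * eta) <= m%:R * eta by rewrite ler_piMl// mulr_ge0.
lra.
Qed.

(** Order of the choices: [m] brings the m-th moment of [G rho] close to its atom, r0 = 1 - 1/(2m)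
    then satisfies r0^m >= 1/2, and [j] comes last, against the Gaussian peak determined by [r0].
    None of them depends on [k]. *)
Lemma grid_near_le_uniform (delta : R) : 0 < delta -> exists j, forall k,
  (P (ev [set y | `|y| < j.+1%:R^-1]%R k (2 ^ k)) <= (atom rho + delta)%:E)%E.
Proof.
move=> delta0; set b := atom rho.
have b0 : 0 < b by rewrite atom_pos// ltW.
have bd0 : 0 < b * delta by rewrite mulr_gt0.
have [m m0 Lm] : exists2 m, (0 < m)%N & 2 * (rho `^ (- psi m%:R) - b) <= b * delta / 2.
  have /cvgrPdist_lt /(_ (b * delta / 4)) := laplace_cvg_fine_atom G01 laplaceG (ltW rho1).
  rewrite divr_gt0// => /(_ isT) h.
  near \oo => m; exists m; first by near: m; exact: nbhs_infty_gt.
  have : `|b - rho `^ (- psi m%:R)| < b * delta / 4 by near: m.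
  by rewrite ltr_norml => /andP[]; lra.
pose r0 : R := 1 - (m.*2)%:R^-1.
have m2 : 0 < m.*2%:R :> R by rewrite ltr0n double_gt0.
have r00 : 0 <= r0 by rewrite subr_ge0 invf_le1// ler1n double_gt0.
have r01 : r0 < 1 by rewrite ltrBlDr ltrDl invr_gt0.
pose K := 3 * normal_peak (Num.sqrt (s * (1 - r0))).
have K0 : 0 <= K by rewrite mulr_ge0// normal_peak_ge0.
have [j je] : exists j, K * j.+1%:R^-1 <= b * delta / 2.
  have c0 : 0 < b * delta / 2 / (K + 1) by rewrite !divr_gt0// ltr_wpDl.
  have [j] := ltr_add_invr c0; rewrite add0r => jlt; exists j.
  rewrite -[leRHS](divfK (_ : K + 1 != 0)) ?gt_eqF ?ltr_wpDl// mulrC.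
  by rewrite ler_pM// ?invr_ge0// ?(ltW jlt)// lerDl.
exists j => k; have e0 : 0 < j.+1%:R^-1 :> R by rewrite invr_gt0.
apply: le_trans (grid_near_le k (2 ^ k) e0 r00 r01) _; rewrite lee_fin.
have qX : atom (r k) ^+ (2 ^ k) = b by rewrite /atom -(atomX G01 laplaceG _ (r_ge1 k)) rX.
have q0 := ltW (atom_pos (r_ge1 k)).
(* Since q^n = b for n = 2^k, both b n (1 - q) and b n (L - q) are bounded by quantities at [rho],
   free of [k]. This is why the goal is multiplied by [b] below. *)
have := @exprn_sub_ge _ 1 (atom (r k)) (2 ^ k) q0 (atom_le1 _) (atom_le1 _).
have := @exprn_sub_ge _ (r k `^ (- psi m%:R)) (atom (r k)) (2 ^ k) q0
  (atom_le_laplace laplaceG (r_ge1 k) m0) (atom_le1 _).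
rewrite -laplaceX ?r_ge1// rX qX expr1n => h1 h2.
have h3 := laplace_tail laplaceG (r_ge1 k) m0 r00 (half_le_exprn R m0).
set q := atom (r k) in h1 h2 h3 *; set L := (r k `^ _) in h1 h3; set g := fine _ in h3 *.
rewrite lerD2l.
have n0 : 0 <= (2 ^ k)%:R :> R by [].
set n := (2 ^ k)%:R in h1 h2 n0 *.
rewrite -(ler_pM2l b0) mulrDr mulrDr.
set Le := rho `^ _ in Lm h1.
have t1 : b * (n * g) <= b * delta / 2.
  apply: le_trans Lm; apply: (@le_trans _ _ (2 * (b * (n * (L - q))))); last by lra.
  rewrite (_ : 2 * _ = b * (n * (2 * (L - q)))); last by ring.
  by apply: ler_wpM2l; [exact: ltW|exact: ler_wpM2l].
have t2 : b * (n * (3 * j.+1%:R^-1 * normal_peak (Num.sqrt (s * (1 - r0))) *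
    (1 - q))) <= b * delta / 2.
  apply: le_trans je.
  rewrite (_ : b * _ = K * j.+1%:R^-1 * (b * (n * (1 - q)))); last by rewrite /K; ring.
  apply: ler_piMr; first by rewrite mulr_ge0// ltW.
  by apply: le_trans h2 _; lra.
by rewrite (splitr (b * delta)) addrC lerD// addrC.
Unshelve. all: by end_near. Qed.

Let no_jump_event := [set w | forall u, s < u -> u <= s * rho ^+ 2 ->
  X u w = left_limit (fun v => X v w) u].

Hypothesis cadlagX : forall w, cadlag (fun u => X u w).

Let eball j := [set y : R | `|y| < j.+1%:R^-1].
Let meball j : measurable (eball j).
Proof.
rewrite (_ : eball j = [set` `]-j.+1%:R^-1, j.+1%:R^-1[]); first exact: measurable_itv.
by apply/seteqP; split => y; rewrite /eball /= in_itv/= ltr_norml.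
Qed.

Let tail j N := \bigcap_(k in [set k | (N <= k)%N]) ev (eball j) k (2 ^ k).

Let mtail j N : measurable (tail j N).
Proof. by apply: bigcap_measurable => [|k _]; [exists N => /=|exact: mev]. Qed.

(** The two path lemmas, with e restricted to 1/(j+1), reduce the event to countably many
    increments; measurability follows. *)
Lemma no_jump_eventE : no_jump_event = \bigcap_j \bigcup_N tail j N.
Proof.
apply/seteqP; split => w.
  move=> nj j _.
  have e0 : 0 < j.+1%:R^-1 :> R by rewrite invr_gt0.
  have [N _ h] := no_jump_grid_increment s0 rho1 (cadlagX w) nj e0.
  by exists N => // k /= Nk i ik; exact: (h k Nk i ik).
move=> h; apply: (grid_increment_no_jump s0 rho1 (cadlagX w)) => e e0.
have [j je] := ltr_add_invr e0; rewrite add0r in je.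
have [N _ hN] := h j I; exists N => // k /= Nk i ik.
by apply: lt_trans je; exact: (hN k Nk i ik).
Qed.

Lemma measurable_no_jump_event : measurable no_jump_event.
Proof.
rewrite no_jump_eventE; apply: bigcapT_measurable => j.
by apply: bigcup_measurable => N _.
Qed.

Lemma probability_no_jump : P no_jump_event = G rho [set 1].
Proof.
have mC := measurable_no_jump_event; rewrite -atomE.
apply/eqP; rewrite eq_le; apply/andP; split.
  rewrite -(fineK (fin_num_measure P _ mC)) lee_fin; apply/ler_addgt0Pr => delta delta0.
  have [j hj] := grid_near_le_uniform delta0.
  rewrite -lee_fin fineK ?fin_num_measure//.
  have mU : measurable (\bigcup_N tail j N) by exact: bigcup_measurable.
  apply: (@le_trans _ _ (P (\bigcup_N tail j N))).
    by apply: le_measure; rewrite ?inE// no_jump_eventE => w /(_ j I).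
  (* The tails increase with [N], and each is bounded through its single level k = N. *)
  have c : P (tail j N) @[N --> \oo] --> P (\bigcup_N tail j N).
    apply: nondecreasing_cvg_mu => // M N MN; apply/subsetPset => w h k /= Nk.
    by apply: h; exact: leq_trans MN Nk.
  rewrite -(cvg_lim _ c)//; apply: lime_le; first by apply/cvg_ex; eexists; exact: c.
  apply: nearW => N; apply: le_trans (hj N); apply: le_measure; rewrite ?inE//.
    by apply: mev; exact: meball.
  by move=> w /(_ N); apply => /=.
pose A k := ev [set 0] k (2 ^ k).
have mA k : measurable (A k) by apply: mev; exact: measurable_set1.
have mbA : measurable (\bigcap_k A k) by exact: bigcapT_measurable.
apply: (@le_trans _ _ (P (\bigcap_k A k))); last first.
  apply: le_measure; rewrite ?inE// no_jump_eventE => w h j _; exists 0%N => // k _ i ik.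
  by rewrite /eball /= (h k I i ik) normr0 invr_gt0.
have c : P (A k) @[k --> \oo] --> P (\bigcap_k A k).
  apply: nonincreasing_cvg_mu => //; first by rewrite ltey_eq fin_num_measure.
  (* A cell of level k is cut in two at level k + 1. If both half-increments vanish, the path is
     multiplied twice by the finer root, that is once by the coarser one, so the increment over the
     whole cell vanishes. *)
  apply/nonincreasing_seqP => k; apply/subsetPset => w h i ik.
  have i1 : (2 * i < 2 ^ k.+1)%N by rewrite expnS ltn_mul2l.
  have i2 : ((2 * i).+1 < 2 ^ k.+1)%N.
    by rewrite expnS (@leq_trans (2 * i.+1)) ?leq_mul2l ?mulnS.
  have d1 : D k.+1 (2 * i) w = 0 := h _ i1.
  have d2 : D k.+1 (2 * i).+1 w = 0 := h _ i2.
  have dbl : (2 * i).+2 = (2 * i.+1)%N by rewrite mulnS.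
  move: d1 d2; rewrite /D /grid_increment dbl !grid_double//.
  move=> /eqP; rewrite subr_eq0 => /eqP -> /eqP; rewrite subr_eq0 mulrA -expr2 iter_sqrtS//.
  by move=> /eqP; rewrite /= => ->; rewrite subrr.
rewrite -(cvg_lim _ c)//; apply: lime_ge; first by apply/cvg_ex; eexists; exact: c.
apply: nearW => k; rewrite -(rX k) /atom (atomX G01 laplaceG)//; exact: grid_exact_ge.
Qed.

End no_jump.

(** * From fixed intervals to the first jump time *)

Unset Implicit Arguments.

Theorem proposition9 (R : realType)
    (G : R -> probability (measurableTypeR R) R)
    (beta : R) (nu : {measure set (measurableTypeR R) -> \bar R})
    (hG : log_convolution_semigroup G)
    (hnu : drift_levy_pair beta nu)
    (hpsi : has_laplace_exponent G (laplace_exponent beta nu))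
    (hpsi_half : laplace_exponent beta nu (1 / 2) = 1)
    (d : measure_display) (T : measurableType d) (P : probability T R)
    (X : R -> {RV P >-> R})
    (hX0 : forall w, X 0 w = 0)
    (hXcadlag : forall w, cadlag (fun t => X t w))
    (hXmartingale : martingale X)
    (hXmarkov : markov_with_transition X (transition G))
    (hgamma : forall sigma : R, 1 <= sigma -> (0 < G sigma [set 1%R])%E)
    (s t : R) (hs : 0 < s) (hst : s < t) :
  P [set w | (t%:E < first_jump_after (fun u => X u w) s)%E]
  = G (Num.sqrt (t / s)) [set 1].
Proof.
set rho := Num.sqrt (t / s).
have ts1 : 1 < t / s by rewrite ltr_pdivlMr// mul1r.
have rho1 : 1 < rho by rewrite -[X in X < _]sqrtr1 ltr_sqrt// (lt_trans _ ts1).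
have rho0 : 0 <= rho by rewrite (le_trans _ (ltW rho1)).
have tE : s * rho ^+ 2 = t by rewrite sqr_sqrtr ?(le_trans _ (ltW ts1))// mulrC divfK ?gt_eqF.
have [G01 _] := hG.
pose r k := iter k Num.sqrt rho.
have r1 k : 1 < r k by exact: iter_sqrt_gt1.
pose C (a : R) := [set w | forall u, s < u -> u <= s * a ^+ 2 ->
  X u w = left_limit (fun v => X v w) u].
have mC a : 1 < a -> measurable (C a).
  by move=> a1; exact: (measurable_no_jump_event hs a1 hXcadlag).
have PC a : 1 < a -> P (C a) = G a [set 1].
  by move=> a1; exact: (probability_no_jump G01 hpsi hgamma hXmarkov hs a1 hXcadlag).
have rr1 k : 1 < rho * r k by rewrite (lt_trans rho1)// ltr_pMr ?(lt_trans _ rho1).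
have trk k : s * (rho * r k) ^+ 2 = t * r k ^+ 2 by rewrite exprMn mulrA tE.
have t0 : 0 < t by exact: lt_trans hst.
have tr_gt k : t < t * r k ^+ 2 by rewrite ltr_pMr// exprn_egt1.
(* Absence of jumps in ]s, t] does not give T_s > t, as jumps might accumulate at t from the right;
   a margin beyond t is needed, and t r_k^2 decreases to t. *)
have -> : [set w | (t%:E < first_jump_after (fun u => X u w) s)%E] =
    \bigcup_k C (rho * r k).
  apply/seteqP; split => w /=.
    rewrite /first_jump_after; set I := ereal_inf _ => tI.
    have [k kI] : exists k, ((t * r k ^+ 2)%:E < I)%E.
      have c : (t * r k ^+ 2) @[k --> \oo] --> t.
        have c1 := iter_sqrt_cvg1 rho1.
        have := @cvgM _ _ _ _ _ _ _ _ (@cvgM _ _ _ _ _ _ _ _ c1 c1) (cvg_cst t).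
        rewrite mulr1 mul1r => c2; under eq_cvg do rewrite mulrC expr2.
        exact: c2.
      move: tI; case: I => [i| |]//; last by move=> _; exists 0%N; rewrite ltry.
      rewrite lte_fin => ti.
      have it0 : 0 < i - t by rewrite subr_gt0.
      move/cvgrPdist_lt : c => /(_ _ it0) [N _ /(_ N (leqnn N))] h.
      exists N; rewrite lte_fin; move: h; rewrite ltr_norml => /andP[+ _]; lra.
    exists k => // u su; rewrite trk => ur; apply/eqP/negPn/negP => /eqP nj.
    have : (I <= u%:E)%E by apply: ereal_inf_lbound; exists u.
    by rewrite leNgt (le_lt_trans _ kI)// lee_fin.
  move=> [k _ Ck]; apply: (@lt_le_trans _ _ (t * r k ^+ 2)%:E); first by rewrite lte_fin.
  apply: le_ereal_inf_tmp => _ [u [su nj] <-]; rewrite lee_fin leNgt; apply/negP => ur.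
  by apply: nj; apply: Ck => //; rewrite trk ltW.
have mU : measurable (\bigcup_k C (rho * r k)) by apply: bigcup_measurable => k _; exact: mC.
apply/eqP; rewrite eq_le; apply/andP; split.
  rewrite -PC//; apply: le_measure; rewrite ?inE//; first exact: mC.
  move=> w [k _ Ck] u su ut; apply: Ck => //; apply: le_trans ut _.
  by rewrite trk tE ltW.
(* Conversely the margin costs at most 1/(k+1) in probability, by [iter_sqrt_atom_gap]. *)
rewrite -(fineK (fin_num_measure P _ mU)).
rewrite -(fineK (fin_num_measure (G rho) _ (measurable_set1 1))) lee_fin.
apply/ler_addgt0Pr => e e0.
have [k ke] := ltr_add_invr e0; rewrite add0r in ke.
apply: le_trans (iter_sqrt_atom_gap G01 hpsi hgamma k rho1) _.
apply: lerD; last exact: ltW.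
have le1 : 1 <= r k by exact: ltW.
(* Both [rho] and [rho * r k] are integer powers of [r k], so [atomX] gives the product formula for
   the atoms. *)
have rE : rho * r k = r k ^+ (2 ^ k).+1 by rewrite exprSr iter_sqrtXn.
have bq : fine (G rho [set 1]) * fine (G (r k) [set 1]) = fine (G (rho * r k) [set 1]).
  by rewrite rE (atomX G01 hpsi) // exprSr -(atomX G01 hpsi) // iter_sqrtXn.
rewrite bq -lee_fin !fineK ?fin_num_measure// -PC//.
by apply: le_measure; rewrite ?inE//; [exact: mC|move=> w Cw; exists k].
Qed.
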